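(* There exists a finite modular lattice $L$ which, regarded as a poset, is not integral. Explicitly, there exists a finite modular lattice $L$ such that for no field $K$ does there exist a noetherian graded $K$-algebra $R=\bigoplus_{n\ge 0}R_n$ with $R_0=K$ that is an integral domain and is an algebra with straightening laws on $L$ over $K$ with respect to an injection $\varphi:L\hookrightarrow R_1$.
   Context: All posets (partially ordered sets) are finite. A lattice $L$ is modular if for all $a,b,c\in L$ with $a\le c$ one has $a\vee(b\wedge c)=(a\vee b)\wedge c$. Algebras with straightening laws. Let $R=\bigoplus_{n=0}^\infty R_n$ be a noetherian (commutative) graded algebra over a field $R_0=K$. Let $P$ be a poset, and let $\varphi:P\hookrightarrow\bigcup_{n\ge1}R_n$ be an injection such that $R$ is generated by $\varphi(P)$ as a $K$-algebra. A standard monomial is a homogeneous element of $R$ of the form $\varphi(\gamma_1)\varphi(\gamma_2)\cdots\varphi(\gamma_s)$ with $\gamma_1\le\gamma_2\le\cdots\le\gamma_s$ in $P$ (the empty product $1$, with $s=0$, is included; different multichains are regarded as giving different standard monomials). $R$ is called an algebra with straightening laws (ASL) on $P$ over $K$ if: (ASL-1) the set of standard monomials is a $K$-basis of $R$; (ASL-2) if $\alpha,\beta\in P$ are incomparable and $\varphi(\alpha)\varphi(\beta)=\sum_i r_i\,\varphi(\gamma_{i_1})\varphi(\gamma_{i_2})\cdots$, with $0\ne r_i\in K$ and $\gamma_{i_1}\le\gamma_{i_2}\le\cdots$, is the unique expression of $\varphi(\alpha)\varphi(\beta)$ as a linear combination of distinct standard monomials given by (ASL-1), then $\gamma_{i_1}\le\alpha$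 and $\gamma_{i_1}\le\beta$ for every $i$. (The right-hand side may be the empty sum $0$.) A poset $P$ is called integral if there exist a field $K$ and a noetherian graded domain $R=\bigoplus_{n\ge0}R_n$ with $R_0=K$ such that $R$ is an ASL on $P$ over $K$ with an injection $\varphi:P\hookrightarrow R_1$ (in particular $R=K[R_1]$ is a homogeneous domain). *)

(* Defs.v *)
From HB Require Import structures.
From mathcomp Require Import all_boot all_order all_algebra.

Set Implicit Arguments.
Unset Strict Implicit.
Unset Printing Implicit Defensive.

Import Order.TTheory GRing.Theory.
Local Open Scope ring_scope.

(* Subsets of a ring are Prop-valued predicates, so that ideals, homogeneous  *)
(* components and subalgebras need not be decidable; this is why the closure  *)
(* conditions of ssralg, which are about {pred R}, are restated in Prop.      *)

Definition modular_lattice (d : Order.disp_t) (L : latticeType d) : Prop :=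
  forall a b c : L, (a <= c)%O ->
    (a `|` (b `&` c))%O = ((a `|` b) `&` c)%O.

Record is_ideal (R : comNzRingType) (I : R -> Prop) : Prop := IsIdeal {
  ideal0 : I 0;
  idealD : forall x y, I x -> I y -> I (x + y);
  idealM : forall a x, I x -> I (a * x)
}.

Definition noetherian (R : comNzRingType) : Prop :=
  forall I : R -> Prop, is_ideal I ->
    exists (n : nat) (g : 'I_n -> R),
      forall x, I x <-> exists a : 'I_n -> R, x = \sum_(i < n) a i * g i.

Record is_submod (K : fieldType) (R : comAlgType K) (V : R -> Prop) : Prop :=
  IsSubmod {
    submod0 : V 0;
    submodD : forall x y, V x -> V y -> V (x + y);
    submodZ : forall (k : K) x, V x -> V (k *: x)
  }.

Record is_subalg (K : fieldType) (R : comAlgType K) (S : R -> Prop) : Prop :=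
  IsSubalg {
    subalg_submod : is_submod S;
    subalg1 : S 1;
    subalgM : forall x y, S x -> S y -> S (x * y)
  }.

Definition alg_generated (K : fieldType) (R : comAlgType K) (T : Type)
    (f : T -> R) : Prop :=
  forall S : R -> Prop, is_subalg S -> (forall t, S (f t)) -> forall x, S x.

(* gr_span and gr_free together say that R is the direct sum of the G n. *)
Record is_grading (K : fieldType) (R : comAlgType K) (G : nat -> R -> Prop) :
    Prop := IsGrading {
  gr_submod : forall n, is_submod (G n);
  gr_span : forall x, exists (n : nat) (u : nat -> R),
    (forall i, G i (u i)) /\ x = \sum_(i < n) u i;
  gr_free : forall (n : nat) (u : nat -> R),
    (forall i, G i (u i)) -> \sum_(i < n) u i = 0 ->
    forall i, (i < n)%N -> u i = 0;
  gr_mul : forall m n x y, G m x -> G n y -> G (m + n)%N (x * y);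
  gr_zero : forall x, G 0%N x <-> exists k : K, x = k%:A
}.

(* A standard monomial is indexed by the multichain g_1 <= ... <= g_s of its  *)
(* factors, so that different multichains count as different monomials.       *)
Definition multichain (d : Order.disp_t) (P : finPOrderType d) (m : seq P) :
  bool := sorted <=%O m.

Definition std_monomial (K : fieldType) (R : comAlgType K)
    (d : Order.disp_t) (P : finPOrderType d) (phi : P -> R) (m : seq P) : R :=
  \prod_(p <- m) phi p.

Definition distinct_multichains (d : Order.disp_t) (P : finPOrderType d)
    (t : seq (seq P)) : bool := uniq t && all (@multichain d P) t.

Definition std_comb (K : fieldType) (R : comAlgType K)
    (d : Order.disp_t) (P : finPOrderType d) (phi : P -> R)
    (t : seq (seq P)) (c : seq P -> K) : R :=
  \sum_(m <- t) c m *: std_monomial phi m.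

(* Algebra with straightening laws on P over K with respect to phi.           *)
(* asl_free and asl_span are (ASL-1). In asl_straight the multichain m has a  *)
(* first element: phi takes values in positive degrees, hence the standard    *)
(* monomial 1 cannot occur in phi a * phi b.                                  *)
Record is_ASL (K : fieldType) (R : comAlgType K) (G : nat -> R -> Prop)
    (d : Order.disp_t) (P : finPOrderType d) (phi : P -> R) : Prop := IsASL {
  asl_noetherian : noetherian R;
  asl_grading : is_grading G;
  asl_inj : injective phi;
  asl_pos : forall p, exists n, (0 < n)%N /\ G n (phi p);
  asl_gen : alg_generated phi;
  asl_span : forall x, exists (t : seq (seq P)) (c : seq P -> K),
    distinct_multichains t /\ x = std_comb phi t c;
  asl_free : forall (t : seq (seq P)) (c : seq P -> K),
    distinct_multichains t -> std_comb phi t c = 0 ->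
    forall m, m \in t -> c m = 0;
  asl_straight : forall (a b : P) (t : seq (seq P)) (c : seq P -> K),
    (a >< b)%O -> distinct_multichains t ->
    (forall m, m \in t -> c m != 0) ->
    phi a * phi b = std_comb phi t c ->
    forall m, m \in t ->
      exists (g : P) (m' : seq P), [/\ m = g :: m', (g <= a)%O & (g <= b)%O]
}.

Definition integral_poset (d : Order.disp_t) (P : finPOrderType d) : Prop :=
  exists (K : fieldType) (R : comAlgType K) (G : nat -> R -> Prop)
      (phi : P -> R),
    [/\ GRing.integral_domain_axiom R,
        is_ASL G phi
      & forall p, G 1%N (phi p)].

(* Main.v *)
Require Import Defs.
From HB Require Import structures.
From mathcomp Require Import all_boot all_order all_algebra zify ring.
From mathcomp Require Import boolp mpoly.

(** The counterexample is a planar lattice: the grid {0,...,m}^2 with n further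
    elements, called eyes, inserted into the corner square with bottom (m-1,0)
    and top (m,1).  It is modular because its height function rho satisfies
    rho x + rho y = rho (x \/ y) + rho (x /\ y).

    Let R be a domain that is an ASL on it, with all generators in degree 1.
    Let theta_r be the sum of the generators of rank r, and let S be the
    polynomial ring in the theta_r.  With a weight that decreases fast with the
    rank, straightening a product of incomparable elements only produces
    standard monomials of higher weight.  Hence, up to higher weight,
    theta_r * m is the sum of the standard monomials q m over those q of rank r
    that are comparable with all of m, as in the Stanley-Reisner ring.  When
    there is only one such q ([theta_pins]), this can be read in two ways.
    - It rewrites q m as a multiple of m.  Since the elements comparable with an
      eye form a chain, R is spanned over S by the n eyes and by c products of
      grid elements, with c independent of n, and the part of degree at most 2
      is spanned by the n eyes and t products of at most two grid elements
      ([reduction_ind]).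
    - It computes the leading term of a product of theta's with a monomial
      supported on a maximal chain, so that the n eyes together with the 2^m
      monomials of the maximal chains running along the diagonal are linearly
      independent over S ([free_cores]).

    For m = 17 one has t < 2^m, so the products of two eyes do not span R up to
    S-torsion: some nonzero S-linear form lambda on R kills all of them.  If
    n > c, some nonzero S-combination v of the eyes satisfies lambda (v a) = 0
    for each of the c other generators a, hence lambda (v R) = 0.  But R is a
    domain of finite rank over S, so v R has full rank and lambda = 0, a
    contradiction ([square_span_full]). *)

Set Implicit Arguments.
Unset Strict Implicit.
Unset Printing Implicit Defensive.
Import Order.TTheory GRing.Theory.
Local Open Scope ring_scope.

(** * Linear algebra over a domain acting on a ring *)

Section LinearDependence.
Variable S : idomainType.

(** A matrix with more rows than columns becomes singular once padded to a square
    matrix by zero columns. *)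
Lemma exists_left_kernel (I J : finType) (a : I -> J -> S) :
  (#|J| < #|I|)%N ->
  exists2 u : I -> S, (exists i, u i != 0)
    & forall j, \sum_i u i * a i j = 0.
Proof.
move=> ltJI.
pose A : 'M[S]_(#|I|) := \matrix_(i, j)
  if (insub (j : nat) : option 'I_#|J|) is Some j' then a (enum_val i) (enum_val j') else 0.
have /eqP/det0P[v nzv vA0] : \det A = 0.
  rewrite -det_tr (expand_det_row _ (Ordinal ltJI)) big1 // => j _.
  rewrite !mxE insubF ?mul0r //=; exact: ltnn.
exists (fun i => v 0 (enum_rank i)).
  have /existsP[i nzi] : [exists i, v 0 i != 0].
    apply: contraNT nzv; rewrite negb_exists => /forallP v0.
    by apply/eqP/rowP=> i; rewrite mxE; apply/eqP/negPn/v0.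
  by exists (enum_val i); rewrite enum_valK.
move=> j; have := congr1 (fun M : 'rV_ _ => M 0 (widen_ord (ltnW ltJI) (enum_rank j))) vA0.
rewrite !mxE (reindex_onto enum_rank enum_val) /=; last by move=> i _; rewrite enum_valK.
move=> e; rewrite -[RHS]e; apply: eq_big=> [i|i _]; first by rewrite enum_rankK eqxx.
rewrite !mxE enum_rankK; case: insubP => [j' _ /= ej|]; last first.
  by case/negP; apply: (ltn_ord (enum_rank j)).
by rewrite (val_inj ej : j' = enum_rank j) enum_rankK.
Qed.

(** Forgetting the column [i0] leaves fewer columns than rows; a left kernel
    vector of the rest also kills the column [i0], because [l] expresses [l i0]
    times that column through the others. *)
Lemma left_kernel_of_right_kernel (I : finType) (a : I -> I -> S) (l : I -> S) (i0 : I) :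
  l i0 != 0 -> (forall i, \sum_j a i j * l j = 0) ->
  exists2 u : I -> S, (exists i, u i != 0)
    & forall j, \sum_i u i * a i j = 0.
Proof.
move=> nzl al0.
have lt_card : (#|{: {j : I | j != i0}}| < #|I|)%N.
  rewrite card_sig (cardD1 i0 I) add1n ltnS; apply: subset_leq_card.
  by apply/subsetP=> j; rewrite !inE andbT.
have [u nzu ua0] := exists_left_kernel (fun i (j : {j : I | j != i0}) => a i (val j)) lt_card.
have ua0' j : j != i0 -> \sum_i u i * a i j = 0 by move=> nj; apply: (ua0 (Sub j nj)).
exists u => // j; have [->|/ua0' //] := eqVneq j i0.
have : \sum_j (\sum_i u i * a i j) * l j = 0.
  under eq_bigr do rewrite mulr_suml; rewrite exchange_big big1 //= => i _.
  by under eq_bigr do rewrite -mulrA; rewrite -mulr_sumr al0 mulr0.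
rewrite (bigD1 i0) //= [X in _ + X]big1 ?addr0; last by move=> k /ua0' ->; rewrite mul0r.
by move/eqP; rewrite mulf_eq0 (negbTE nzl) orbF => /eqP.
Qed.

End LinearDependence.

Section FreeFamilies.
Variables (S : idomainType) (R : comNzRingType) (iota : {rmorphism S -> R}).

Definition free_family (I : finType) (b : I -> R) :=
  forall u : I -> S, \sum_i iota (u i) * b i = 0 -> forall i, u i = 0.

Definition spanned_by (I : finType) (b : I -> R) (x : R) :=
  exists u : I -> S, x = \sum_i iota (u i) * b i.

Section Span.
Variables (I : finType) (b : I -> R).

Lemma spanned0 : spanned_by b 0.
Proof. by exists (fun=> 0); rewrite big1 // => i _; rewrite rmorph0 mul0r. Qed.

Lemma spannedD x y : spanned_by b x -> spanned_by b y -> spanned_by b (x + y).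
Proof.
move=> [u ->] [v ->]; exists (fun i => u i + v i); rewrite -big_split /=.
by apply: eq_bigr => i _; rewrite rmorphD mulrDl.
Qed.

Lemma spannedM s x : spanned_by b x -> spanned_by b (iota s * x).
Proof.
move=> [u ->]; exists (fun i => s * u i); rewrite mulr_sumr.
by apply: eq_bigr => i _; rewrite rmorphM mulrA.
Qed.

Lemma spanned_sum (J : Type) (r : seq J) (F : J -> R) :
  (forall j, spanned_by b (F j)) -> spanned_by b (\sum_(j <- r) F j).
Proof.
by move=> bF; elim/big_ind: _ => //; [apply: spanned0 | apply: spannedD].
Qed.

Lemma spanned_gen i : spanned_by b (b i).
Proof.
exists (fun j => (j == i)%:R); rewrite (bigD1 i) //= eqxx rmorph1 mul1r big1 ?addr0 //.
by move=> j /negbTE ->; rewrite rmorph0 mul0r.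
Qed.

End Span.

Lemma spanned_sub (I J : finType) (b : I -> R) (c : J -> R) x :
  (forall i, spanned_by c (b i)) -> spanned_by b x -> spanned_by c x.
Proof.
by move=> cb [u ->]; apply: spanned_sum => i; apply: spannedM.
Qed.


(** The factor [s] allows for [b] lying in the span of [c] only up to torsion. *)
Lemma free_card_le (I J : finType) (b : I -> R) (c : J -> R) s :
  s != 0 -> (forall i, spanned_by c (iota s * b i)) -> free_family b -> (#|I| <= #|J|)%N.
Proof.
move=> nzs cb freeb; rewrite leqNgt; apply/negP=> ltJI.
have [a ab] := choice cb.
have [u [i nzu] ua0] := exists_left_kernel a ltJI.
suff /freeb/(_ i)/eqP : \sum_i iota (u i * s) * b i = 0.
  by rewrite mulf_eq0 (negbTE nzu) (negbTE nzs).
under eq_bigr do rewrite rmorphM -mulrA ab mulr_sumr.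
rewrite exchange_big big1 //= => j _.
under eq_bigr do rewrite mulrA -rmorphM.
by rewrite -mulr_suml -rmorph_sum ua0 rmorph0 mul0r.
Qed.

(** A substitute for a basis of R tensored with the fraction field of S. *)
Lemma exists_maximal_free (G : finType) (g : G -> R) :
  (forall s, iota s = 0 -> s = 0) -> (forall r, spanned_by g r) ->
  exists (d : nat) (b : 'I_d -> R) (s : S),
    [/\ free_family b, s != 0 & forall r, spanned_by b (iota s * r)].
Proof.
move=> injiota spang.
pose P d := `[< exists b : 'I_d -> R, free_family b >].
have exP : exists d, P d.
  by exists 0%N; apply/asboolP; exists (fun=> 0) => u _ [].
have leP d : P d -> (d <= #|G|)%N.
  move/asboolP=> [b freeb]; rewrite -[d]card_ord.
  by apply: (free_card_le (oner_neq0 S) _ freeb) => i; apply: spang.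
case: (ex_maxnP exP leP) => d /asboolP[b freeb] maxd.
(* By maximality, adding any [r] to [b] creates a relation, in which [r] has a
   nonzero coefficient since [b] is free. *)
have dep r : exists s : S, s != 0 /\ spanned_by b (iota s * r).
  pose b' (i : 'I_d.+1) := if unlift ord0 i is Some j then b j else r.
  have [u [u0 [i nzu]]] : exists u : 'I_d.+1 -> S,
      \sum_i iota (u i) * b' i = 0 /\ exists i, u i != 0.
    apply: contrapT => nex; suff /maxd : P d.+1 by rewrite ltnn.
    apply/asboolP; exists b' => u u0 i; apply/eqP/negPn/negP => nzu.
    by apply: nex; exists u; split=> //; exists i.
  move: u0; rewrite big_ord_recl /b' unlift_none => /eqP; rewrite addr_eq0 => /eqP u0.
  exists (u ord0); split.
    apply/eqP=> uz; move: u0 nzu; rewrite uz rmorph0 mul0r => /esym/eqP.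
    rewrite oppr_eq0 => /eqP; under eq_bigr do rewrite liftK.
    move/(freeb (fun j => u (lift ord0 j))) => uj.
    by case: (unliftP ord0 i) => [j ->|->]; rewrite ?uj ?uz eqxx.
  exists (fun j => - u (lift ord0 j)); rewrite u0 -sumrN; apply: eq_bigr => j _.
  by rewrite liftK rmorphN mulNr.
have [s sP] := choice (fun i => dep (g i)).
exists d, b, (\prod_i s i); split=> //.
  by apply/prodf_neq0 => i _; case: (sP i).
move=> r; have [u ->] := spang r; rewrite mulr_sumr; apply: spanned_sum => i.
have [_ spi] := sP i; rewrite (bigD1 i) //=.
rewrite (_ : _ * _ = iota ((\prod_(j | j != i) s j) * u i) * (iota (s i) * g i)); last first.
  by rewrite !rmorphM; ring.
exact: spannedM.
Qed.


(** If R is a domain, if [g] generates it and more than half of the generators,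
    the free family [g (inl _)], have all their pairwise products in the span of
    [h], then this span has full rank.  Over the fraction field this says that a
    subspace V of a finite field extension, of more than half the dimension,
    satisfies V V = E: a linear form lambda killing V V makes V isotropic for the
    form lambda (x y), which is nondegenerate unless lambda = 0. *)
Lemma square_span_full (I J T W : finType) (g : I + J -> R) (h : T -> R) (M : W -> R) :
  GRing.integral_domain_axiom R ->
  free_family (fun i => g (inl i)) ->
  (forall r, spanned_by g r) ->
  (forall i i', spanned_by h (g (inl i) * g (inl i'))) ->
  free_family M ->
  (#|J| < #|I|)%N -> (#|W| <= #|T|)%N.
Proof.
move=> domR freeX spang sqX freeM ltJI; rewrite leqNgt; apply/negP=> ltTW.
have [i0 _] : exists i : I, true.
  by have /card_gt0P[i] := leq_ltn_trans (leq0n _) ltJI; exists i.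
have injiota t : iota t = 0 -> t = 0.
  move=> t0; apply: (freeX (fun=> t) _ i0).
  by rewrite big1 // => i _; rewrite t0 mul0r.
have [d [b [s [freeb nzs spanb]]]] := exists_maximal_free injiota spang.
(* [kap r] are the coordinates of [s * r] in the free family [b]. *)
have [kap kapP] := choice spanb.
have lt_Td : (#|T| < #|'I_d|)%N.
  by apply: (leq_trans ltTW); apply: (free_card_le nzs _ freeM) => w; apply: spanb.
have [l [k0 nzl] lh0] := exists_left_kernel (fun k t => kap (h t) k) lt_Td.
pose lam r := \sum_k l k * kap r k.
have lam_sum (Q : finType) (u : Q -> S) (x : Q -> R) :
    lam (\sum_q iota (u q) * x q) = \sum_q u q * lam (x q).
  have kapE k : kap (\sum_q iota (u q) * x q) k = \sum_q u q * kap (x q) k.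
    apply/eqP; rewrite -subr_eq0; apply/eqP; move: k.
    apply: freeb; under eq_bigr do rewrite rmorphB mulrBl.
    rewrite big_split /= sumrN -kapP mulr_sumr; apply/eqP; rewrite subr_eq0; apply/eqP.
    under [RHS]eq_bigr do rewrite rmorph_sum mulr_suml.
    rewrite exchange_big; apply: eq_bigr => q _; rewrite mulrCA kapP mulr_sumr.
    by apply: eq_bigr => k _; rewrite rmorphM mulrA.
  rewrite /lam; under eq_bigr do rewrite kapE mulr_sumr.
  rewrite exchange_big; apply: eq_bigr => q _; rewrite mulr_sumr.
  by apply: eq_bigr => k _; rewrite mulrCA.
have lam_sq i i' : lam (g (inl i) * g (inl i')) = 0.
  have [u ->] := sqX i i'; rewrite lam_sum big1 // => t _.
  by rewrite /lam lh0 mulr0.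
(* Orthogonality of [v] to the generators [g (inr _)] is #|J| equations in #|I|
   unknowns; to the generators [g (inl _)] it is automatic. *)
have [u [i1 nzu] uA0] := exists_left_kernel (fun i j => lam (g (inl i) * g (inr j))) ltJI.
pose v := \sum_i iota (u i) * g (inl i).
have nzv : v != 0 by apply/eqP=> /freeX u0; rewrite u0 eqxx in nzu.
have lam_v r : lam (v * r) = 0.
  have lam_vg q : lam (v * g q) = 0.
    rewrite mulr_suml; under eq_bigr do rewrite -mulrA.
    rewrite lam_sum; case: q => [i|j]; last exact: uA0.
    by rewrite big1 // => i' _; rewrite lam_sq mulr0.
  have [w ->] := spang r; rewrite mulr_sumr; under eq_bigr do rewrite mulrCA.
  by rewrite lam_sum big1 // => q _; rewrite lam_vg mulr0.
(* Multiplication by [v], written in the coordinates [kap], has [l] in its right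
   kernel; a left kernel vector yields a zero divisor. *)
have [i|w [k nzw] wv0] := left_kernel_of_right_kernel (a := fun i j => kap (v * b i) j) nzl.
  by rewrite -[RHS](lam_v (b i)); apply: eq_bigr => k _; rewrite mulrC.
have sv0 : iota s * (v * \sum_i iota (w i) * b i) = 0.
  rewrite 2!mulr_sumr.
  under eq_bigr => i _ do rewrite (mulrCA v) (mulrCA (iota s)) kapP mulr_sumr.
  rewrite exchange_big big1 //= => j _; under eq_bigr do rewrite mulrA -rmorphM.
  by rewrite -mulr_suml -rmorph_sum wv0 rmorph0 mul0r.
case/orP: (domR _ _ sv0) => [/eqP/injiota s0|/eqP/domR/orP[/eqP v0|/eqP/freeb w0]].
- by rewrite s0 eqxx in nzs.
- by rewrite v0 eqxx in nzv.
- by rewrite w0 eqxx in nzw.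
Qed.

End FreeFamilies.

(** * Straightening and weights *)

Section Straightening.
Variables (K : fieldType) (R : comAlgType K) (G : nat -> R -> Prop).
Variables (disp : Order.disp_t) (P : finPOrderType disp) (phi : P -> R).
Hypotheses (aslR : is_ASL G phi) (phi1 : forall p, G 1%N (phi p)).
Variables (d : nat) (rk : P -> 'I_d).
Hypothesis rk_lt : forall p q, (p < q)%O -> (rk p < rk q)%N.

Local Notation mono := (std_monomial phi).

Lemma mono_cons p m : mono (p :: m) = phi p * mono m.
Proof. exact: big_cons. Qed.

Lemma mono_cat m1 m2 : mono (m1 ++ m2) = mono m1 * mono m2.
Proof. exact: big_cat. Qed.

Lemma mono_perm m1 m2 : perm_eq m1 m2 -> mono m1 = mono m2.
Proof. exact: perm_big. Qed.

Lemma mono_homogeneous m : G (size m) (mono m).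
Proof.
have grG := asl_grading aslR.
elim: m => [|p m IH].
  by rewrite /std_monomial big_nil; apply/(gr_zero grG); exists 1; rewrite scale1r.
by rewrite mono_cons; apply: (gr_mul grG (phi1 p) IH).
Qed.

Definition lincomb (s : seq (K * seq P)) := \sum_(cm <- s) cm.1 *: mono cm.2.
Definition coef_of (s : seq (K * seq P)) m := \sum_(cm <- s | cm.2 == m) cm.1.

Lemma lincombE s t : uniq t -> {subset [seq cm.2 | cm <- s] <= t} ->
  lincomb s = std_comb phi t (coef_of s).
Proof.
move=> ut st; rewrite /lincomb /std_comb.
under [RHS]eq_bigr do rewrite scaler_suml.
rewrite (exchange_big_dep xpredT) //= big_seq [RHS]big_seq; apply: eq_bigr => cm scm.
have tcm : cm.2 \in t by apply: st; apply: map_f.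
rewrite big_mkcond (bigD1_seq cm.2) //= eqxx big1 ?addr0 // => m.
by rewrite eq_sym => /negbTE ->.
Qed.

(** Unlike in [std_comb], the monomials of [s] may be repeated: only the total
    coefficient of each of them has to vanish. *)
Lemma lincomb_free s m : all (fun cm => multichain cm.2) s -> lincomb s = 0 ->
  coef_of s m = 0.
Proof.
move=> chs s0; pose t := undup [seq cm.2 | cm <- s].
have [tm|ntm] := boolP (m \in t).
  apply: (asl_free aslR (t := t)) => //.
    rewrite /distinct_multichains undup_uniq; apply/allP=> m'.
    by rewrite mem_undup => /mapP[cm scm ->]; apply: (allP chs).
  by rewrite -lincombE ?undup_uniq // => m'; rewrite mem_undup.
rewrite /coef_of big_seq_cond big_pred0 // => cm.
apply: contraNF ntm => /andP[scm /eqP <-].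
by rewrite mem_undup map_f.
Qed.

Definition std_span (A : pred (seq P)) (x : R) := exists s,
  all (fun cm => multichain cm.2 && A cm.2) s /\ x = lincomb s.

Section StdSpan.
Variable A : pred (seq P).

Lemma std_span0 : std_span A 0.
Proof. by exists [::]; rewrite /lincomb big_nil. Qed.

Lemma std_spanD x y : std_span A x -> std_span A y -> std_span A (x + y).
Proof.
move=> [s [sA ->]] [t [tA ->]]; exists (s ++ t).
by rewrite all_cat sA tA /lincomb big_cat.
Qed.

Lemma std_spanZ k x : std_span A x -> std_span A (k *: x).
Proof.
move=> [s [sA ->]]; exists [seq (k * cm.1, cm.2) | cm <- s]; split.
  by rewrite all_map.
rewrite /lincomb big_map scaler_sumr; apply: eq_bigr => cm _.
by rewrite scalerA.
Qed.

Lemma std_span_mono m : multichain m -> A m -> std_span A (mono m).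
Proof.
move=> chm Am; exists [:: (1, m)]; rewrite /= chm Am.
by rewrite /lincomb big_seq1 scale1r.
Qed.

Lemma std_span_sum (I : Type) (r : seq I) (Q : pred I) (F : I -> R) :
  (forall i, Q i -> std_span A (F i)) -> std_span A (\sum_(i <- r | Q i) F i).
Proof.
by move=> AF; elim/big_ind: _ => //; [apply: std_span0 | apply: std_spanD].
Qed.

End StdSpan.

Lemma std_span_ind (A : pred (seq P)) (V : R -> Prop) x :
  V 0 -> (forall y z, V y -> V z -> V (y + z)) -> (forall k y, V y -> V (k *: y)) ->
  (forall m, multichain m -> A m -> V (mono m)) -> std_span A x -> V x.
Proof.
move=> V0 VD VZ Vm [s [sA ->]]; rewrite /lincomb big_seq; elim/big_ind: _ => // cm scm.
by have /andP[chm Am] := allP sA _ scm; apply/VZ/Vm.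
Qed.

Lemma std_spanW (A B : pred (seq P)) x : subpred A B -> std_span A x -> std_span B x.
Proof.
move=> AB; apply: std_span_ind; [exact: std_span0 | exact: std_spanD | exact: std_spanZ |].
by move=> m chm /AB; apply: std_span_mono.
Qed.

(** The base 3 makes the weight of any element exceed the sum of the weights of
    any two elements of higher rank. *)
Definition weight (p : P) : nat := 3 ^ (d - rk p).
Definition mweight (m : seq P) : nat := \sum_(p <- m) weight p.

Lemma weight_gt0 p : (0 < weight p)%N.
Proof. by rewrite expn_gt0. Qed.

Lemma weight_lt p q : (p < q)%O -> (3 * weight q <= weight p)%N.
Proof.
move=> /rk_lt ltpq; rewrite /weight -(expnS 3) leq_exp2l //.
by move: ltpq (ltn_ord (rk q)); lia.
Qed.

Lemma mweight_cons p m : mweight (p :: m) = (weight p + mweight m)%N.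
Proof. exact: big_cons. Qed.

Lemma mweight_cat m1 m2 : mweight (m1 ++ m2) = (mweight m1 + mweight m2)%N.
Proof. exact: big_cat. Qed.

Lemma mweight_perm m1 m2 : perm_eq m1 m2 -> mweight m1 = mweight m2.
Proof. exact: perm_big. Qed.

Lemma mweight_le m : (mweight m <= size m * 3 ^ d)%N.
Proof.
elim: m => [|p m IH]; first by rewrite /mweight big_nil.
by rewrite mweight_cons mulSn leq_add // leq_exp2l // leq_subr.
Qed.

(** The first factor of each monomial in the straightening relation lies strictly
    below both [a] and [b], so it alone outweighs them; the grading forces the
    monomials to have degree 2. *)
Lemma product_incomparable (a b : P) : (a >< b)%O ->
  std_span (fun m => (size m == 2) && (weight a + weight b < mweight m)%N)
    (phi a * phi b).
Proof.
move=> ab; have grG := asl_grading aslR.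
have [t0 [c [/andP[ut0 /allP cht0] e0]]] := asl_span aslR (phi a * phi b).
pose t := [seq m <- t0 | c m != 0].
have ut : uniq t by rewrite filter_uniq.
have cht : {in t, forall m, multichain m}.
  by move=> m; rewrite mem_filter => /andP[_ /cht0].
have e : phi a * phi b = std_comb phi t c.
  rewrite e0 /std_comb big_filter [LHS](bigID (fun m => c m != 0)) /= [X in _ + X]big1 ?addr0 //.
  by move=> m /negbNE/eqP ->; rewrite scale0r.
have nzt m : m \in t -> c m != 0 by rewrite mem_filter => /andP[].
have size2 m : m \in t -> size m = 2.
  move=> tm; apply/eqP/negPn/negP => sm2.
  pose u i := \sum_(m <- t | size m == i) c m *: mono m.
  have Gu i : G i (u i).
    have [V0 VD VZ] := gr_submod grG i.
    rewrite /u; elim/big_ind: _ => // m' /eqP sm'; apply: VZ; rewrite -sm'; apply: mono_homogeneous.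
  pose N := (\max_(m <- t) size m + 3)%N.
  have eN : phi a * phi b = \sum_(i < N) u i.
    rewrite e /std_comb /u (exchange_big_dep xpredT) //= big_seq [RHS]big_seq.
    apply: eq_bigr => m' tm'.
    have ltN : (size m' < N)%N.
      by rewrite /N addnS ltnS (leq_trans (@leq_bigmax_seq _ t xpredT size _ tm' isT)) ?leq_addr.
    rewrite (big_pred1 (Ordinal ltN)) // => i; rewrite -val_eqE /= eq_sym; exact: erefl.
  have G2 : G 2 (phi a * phi b) by rewrite -[2%N]/(1 + 1)%N; apply: gr_mul.
  (* The homogeneous components of the relation are those of [phi a * phi b],
     which is concentrated in degree 2. *)
  pose u' i := if i == 2%N then u i - phi a * phi b else u i.
  have Gu' i : G i (u' i).
    rewrite /u'; case: eqP => // ->; have [V0 VD VZ] := gr_submod grG 2.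
    by apply: VD => //; rewrite -scaleN1r; apply: VZ.
  have u'0 : \sum_(i < N) u' i = 0.
    have lt2 : (2 < N)%N by rewrite /N addnS ltnS leq_addl.
    rewrite (bigD1 (Ordinal lt2)) //= /u' eqxx addrAC.
    rewrite (_ : \sum_(i < N | _) _ = \sum_(i < N | i != Ordinal lt2) u i); last first.
      by apply: eq_bigr => i; rewrite -val_eqE => /negbTE /= ->.
    by have := eN; rewrite (bigD1 (Ordinal lt2)) //= => <-; rewrite subrr.
  have ltN : (size m < N)%N.
    by rewrite /N addnS ltnS (leq_trans (@leq_bigmax_seq _ t xpredT size _ tm isT)) ?leq_addr.
  have := gr_free grG Gu' u'0 ltN; rewrite /u' (negbTE sm2) /u -big_filter => um0.
  suff : c m = 0 by apply/eqP/nzt.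
  apply: (asl_free aslR _ um0); last by rewrite mem_filter eqxx.
  rewrite /distinct_multichains filter_uniq //; apply/allP=> m'.
  by rewrite mem_filter => /andP[_ /cht].
rewrite e /std_comb big_seq; apply: std_span_sum => m tm.
apply/std_spanZ/std_span_mono; first exact: cht.
have dist : distinct_multichains t by rewrite /distinct_multichains ut; apply/allP.
have [g [m' [em ga gb]]] := asl_straight aslR ab dist nzt e tm.
rewrite size2 //= em mweight_cons.
have lt_ga : (g < a)%O.
  by rewrite lt_neqAle ga andbT; apply: contraNneq ab => <-; apply: le_comparable.
have lt_gb : (g < b)%O.
  by rewrite lt_neqAle gb andbT; apply: contraNneq ab => <-; apply: ge_comparable.
have := weight_lt lt_ga; have := weight_lt lt_gb; have := weight_gt0 g; lia.
Qed.

Definition filt (D k : nat) := std_span (fun m => (size m == D) && (k <= mweight m)%N).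

Lemma filtW D k k' x : (k' <= k)%N -> filt D k x -> filt D k' x.
Proof.
by move=> lek; apply: std_spanW => m /andP[-> /(leq_trans lek)].
Qed.

Definition is_chain (m : seq P) := all2rel >=<%O m.

Lemma is_chainP m : reflect {in m &, forall p q, (p >=< q)%O} (is_chain m).
Proof. exact: allrelP. Qed.

Lemma sort_multichain m : is_chain m -> multichain (sort <=%O m).
Proof.
move=> /is_chainP chm; apply: (sort_sorted_in (P := mem m)); last exact/allP.
by move=> p q pm qm; apply: chm.
Qed.

Lemma straighten_nonchain m : ~~ is_chain m ->
  (forall m', size m' = size m -> (mweight m < mweight m')%N ->
     filt (size m') (mweight m') (mono m')) ->
  filt (size m) (mweight m).+1 (mono m).
Proof.
move=> nch IH.
have [a [b [m' [ab pm]]]] : exists a b m', (a >< b)%O /\ perm_eq m [:: a, b & m'].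
  have /allPn[a am /allPn[b bm ab]] := nch.
  exists a, b, (rem b (rem a m)); split=> //.
  rewrite (perm_trans (perm_to_rem am)) // perm_cons perm_to_rem //.
  move: (perm_mem (perm_to_rem am) b); rewrite bm inE => /esym.
  by case: eqP ab => [->|//]; rewrite comparablexx.
rewrite (mono_perm pm) (perm_size pm) (mweight_perm pm) !mono_cons mulrA.
move: IH; rewrite (perm_size pm) (mweight_perm pm) => IH.
elim/std_span_ind: (product_incomparable ab).
- by rewrite mul0r; apply: std_span0.
- by move=> y z; rewrite mulrDl; apply: std_spanD.
- by move=> k y; rewrite -scalerAl; apply: std_spanZ.
move=> t _ /andP[/eqP st wt]; rewrite -mono_cat.
have st' : size (t ++ m') = size [:: a, b & m'] by rewrite size_cat st.
have wt' : (mweight [:: a, b & m'] < mweight (t ++ m'))%N.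
  by rewrite !mweight_cons mweight_cat addnA ltn_add2r.
by have := IH _ st' wt'; rewrite st'; apply: filtW.
Qed.

(** Each use of a straightening relation raises the weight, which is bounded in a
    given degree, so the process ends. *)
Lemma straighten m : filt (size m) (mweight m) (mono m).
Proof.
have [n] := ubnP (size m * 3 ^ d - mweight m); elim: n m => // n IHn m le_n.
have [chm|nchm] := boolP (is_chain m); last first.
  apply: (filtW (leqnSn _)); apply: straighten_nonchain => // m' sm' wm'.
  by apply: IHn; have := mweight_le m'; rewrite sm'; lia.
have pm : perm_eq (sort <=%O m) m by rewrite perm_sort.
rewrite -(mono_perm pm); apply: std_span_mono; first exact: sort_multichain.
by rewrite (perm_size pm) (mweight_perm pm) !eqxx leqnn.
Qed.

Lemma straighten_strict m : ~~ is_chain m -> filt (size m) (mweight m).+1 (mono m).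
Proof. by move=> nch; apply: straighten_nonchain => // m' _ _; apply: straighten. Qed.

Definition theta (r : 'I_d) : R := \sum_(p | rk p == r) phi p.

Lemma filt_theta (r : 'I_d) D k x :
  filt D k x -> filt D.+1 (3 ^ (d - r) + k) (theta r * x).
Proof.
move=> fx; rewrite mulr_suml; apply: std_span_sum => p /eqP rkp.
elim/std_span_ind: fx.
- by rewrite mulr0; apply: std_span0.
- by move=> y z; rewrite mulrDr; apply: std_spanD.
- by move=> c y; rewrite -scalerAr; apply: std_spanZ.
move=> m _ /andP[/eqP <- km]; rewrite -mono_cons.
by apply: filtW (straighten (p :: m)); rewrite mweight_cons /weight rkp leq_add2l.
Qed.

(** [p] is the only candidate of its rank to extend the chain [m]. *)
Definition pins (m : seq P) (p : P) :=
  forall q, rk q = rk p -> (forall a, a \in m -> (q >=< a)%O) -> q = p.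

(** Every other term of [theta (rk p) * m] contains an incomparable pair, and all
    the terms have the same weight before straightening. *)
Lemma theta_pins m p : pins m p ->
  filt (size m).+1 (weight p + mweight m).+1 (theta (rk p) * mono m - mono (p :: m)).
Proof.
move=> pinp; rewrite /theta (bigD1 p) //= mulrDl mono_cons addrC addKr.
rewrite mulr_suml; apply: std_span_sum => q /andP[/eqP rkq neqp].
rewrite -mono_cons; have := @straighten_strict (q :: m).
rewrite mweight_cons /weight rkq; apply; apply: contra neqp => /is_chainP chq.
by apply/eqP/pinp => // a am; apply: chq; rewrite inE ?eqxx ?am ?orbT.
Qed.

(** Monomials from which a pinned element can be removed are multiples of a
    [theta] by a smaller monomial, modulo higher weight; so the others generate R
    over the ring of polynomials in the [theta]'s.  [V D] is a candidate for the
    span of these generators in degree at most [D]. *)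
Lemma reduction_ind (V : nat -> R -> Prop) (irr : pred (seq P)) :
  (forall D, V D 0) -> (forall D x y, V D x -> V D y -> V D (x + y)) ->
  (forall D k x, V D x -> V D (k *: x)) ->
  (forall D r x, V D x -> V D.+1 (theta r * x)) ->
  (forall m, multichain m -> irr m -> V (size m) (mono m)) ->
  (forall m, multichain m -> ~~ irr m ->
     exists p m', perm_eq m (p :: m') /\ pins m' p) ->
  forall m, V (size m) (mono m).
Proof.
move=> V0 VD VZ Vtheta Virr red m.
suff filtV D k x : filt D k x -> V D x by apply: filtV (straighten m).
elim: D k x => [|D IHD] k x.
  apply: std_span_ind; [exact: V0 | exact: VD | exact: VZ |] => m' ch /andP[/nilP em' _].
  rewrite em' in ch *; apply: (Virr [::] ch).
  by apply/negPn/negP=> /(red _ ch)[p [m'' [/perm_size]]].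
have [n] := ubnP ((D.+1 * 3 ^ d).+1 - k); elim: n k x => // n IHn k x le_n.
apply: std_span_ind; [exact: V0 | exact: VD | exact: VZ |] => m' ch /andP[/eqP sm' wm'].
have [/(Virr _ ch)|/(red _ ch)[p [m'' [pm' pinp]]]] := boolP (irr m'); first by rewrite sm'.
have /eqP : size m' = (size m'').+1 by rewrite (perm_size pm').
rewrite sm' eqSS => /eqP sm''.
have := theta_pins pinp; rewrite -sm'' -(mono_perm pm') => fdiff.
rewrite (_ : mono m' =
  theta (rk p) * mono m'' + -1 *: (theta (rk p) * mono m'' - mono m')); last first.
  by rewrite scaleN1r opprB addrCA subrr addr0.
apply: VD; first by apply/Vtheta/(IHD (mweight m'')); rewrite sm''; apply: straighten.
apply/VZ/(IHn _ _ _ fdiff); have := mweight_le m'.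
have := mweight_perm pm'; rewrite mweight_cons sm'; lia.
Qed.


Lemma pinsW m m' p : {subset m <= m'} -> pins m p -> pins m' p.
Proof. by move=> mm' pinp q rkq chq; apply: pinp => // a /mm'; apply: chq. Qed.

Definition theta_eval : {mpoly K[d]} -> R := mmap (in_alg R) theta.
HB.instance Definition _ := GRing.RMorphism.on theta_eval.

Lemma theta_evalE (p : {mpoly K[d]}) :
  theta_eval p = \sum_(a <- msupp p) p@_a *: mmap1 theta a.
Proof. by apply: eq_bigr => a _; rewrite mulr_algl. Qed.

(** To each [j] are attached a maximal chain [C j] and a subset [core j] of it
    that pins all the elements of [C j].  Multiplying [core j] by monomials in the
    [theta]'s then gives, as leading terms, the monomials supported on [C j] and
    divisible by [core j].  The last hypothesis says that [core j] is contained in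
    no other chain of the family, so that these leading terms are distinct. *)
Section Cores.
Variables (J : finType) (core : J -> seq P) (C : J -> 'I_d -> P).
Hypotheses (rkC : forall j r, rk (C j r) = r)
  (chainC : forall j r s, (C j r >=< C j s)%O)
  (coreC : forall j p, p \in core j -> C j (rk p) = p)
  (pinC : forall j r, pins (core j) (C j r))
  (core_inj : forall j j', {in core j, forall p, C j' (rk p) = p} -> j = j').

Definition ranks_of (a : 'X_{1..d}) : seq 'I_d :=
  flatten [seq nseq (a r) r | r <- enum 'I_d].

Lemma count_ranks_of a r : count_mem r (ranks_of a) = a r.
Proof.
rewrite count_flatten -map_comp sumnE big_map big_enum /=.
rewrite (bigD1 r) //= count_nseq /= eqxx mul1n big1 ?addn0 // => s /negbTE nsr.
by rewrite count_nseq /= nsr.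
Qed.

Lemma mmap1_ranks_of a : mmap1 theta a = \prod_(r <- ranks_of a) theta r.
Proof.
rewrite big_flatten /= big_map big_enum /=; apply: eq_bigr => r _.
by rewrite big_nseq -Monoid.iteropE.
Qed.

Definition lifted_core (j : J) (a : 'X_{1..d}) : seq P :=
  sort <=%O ([seq C j r | r <- ranks_of a] ++ core j).

Lemma mem_lifted_core j a p : p \in lifted_core j a -> C j (rk p) = p.
Proof.
rewrite mem_sort mem_cat => /orP[/mapP[r _ ->]|]; last exact: coreC.
by rewrite rkC.
Qed.

Lemma lifted_core_multichain j a : multichain (lifted_core j a).
Proof.
apply: sort_multichain; apply/is_chainP => p q pm qm.
have /mem_lifted_core <- : p \in lifted_core j a by rewrite mem_sort.
have /mem_lifted_core <- : q \in lifted_core j a by rewrite mem_sort.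
exact: chainC.
Qed.

Lemma lifted_core_inj j j' a a' :
  lifted_core j a = lifted_core j' a' -> j = j' /\ a = a'.
Proof.
move=> e; have ej : j = j'.
  apply: core_inj => p pj; apply: (@mem_lifted_core _ a').
  by rewrite -e mem_sort mem_cat pj orbT.
split=> //; rewrite -{}ej in e; apply/mnmP=> r.
have /permP/(_ (pred1 (C j r))) : perm_eq ([seq C j r | r <- ranks_of a] ++ core j)
    ([seq C j r | r <- ranks_of a'] ++ core j).
  by rewrite -(perm_sort <=%O) -/(lifted_core j a) e perm_sort.
have injC : injective (C j) by move=> s t /(congr1 rk); rewrite !rkC.
rewrite !count_cat !count_map => /eqP; rewrite eqn_add2r => /eqP.
have preimC : preim (C j) (pred1 (C j r)) =1 pred1 r by move=> s /=; rewrite inj_eq.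
by rewrite !(eq_count preimC) !count_ranks_of.
Qed.

Lemma theta_monomial_core j a :
  std_span (fun m => mweight (lifted_core j a) < mweight m)%N
    (mmap1 theta a * mono (core j) - mono (lifted_core j a)).
Proof.
have pl : perm_eq (lifted_core j a) ([seq C j r | r <- ranks_of a] ++ core j).
  by rewrite perm_sort.
rewrite (mono_perm pl) (mweight_perm pl) mmap1_ranks_of.
suff f : filt (size (map (C j) (ranks_of a) ++ core j))
    (mweight (map (C j) (ranks_of a) ++ core j)).+1
    (\prod_(r <- ranks_of a) theta r * mono (core j) - mono (map (C j) (ranks_of a) ++ core j)).
  by apply: std_spanW f => m /andP[].
elim: (ranks_of a) => [|r s IH]; first by rewrite big_nil mul1r subrr; apply: std_span0.
set m := map _ s ++ _ in IH.
have pinr : pins m (C j r).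
  by apply: (pinsW _ (@pinC j r)) => p; rewrite mem_cat => ->; rewrite orbT.
have := theta_pins pinr; rewrite rkC => f1.
have := filt_theta r IH; rewrite addnS => f2.
rewrite big_cons [map _ _ ++ _]/= -/m mweight_cons /weight rkC.
rewrite (_ : _ - _ = theta r * (\prod_(r <- s) theta r * mono (core j) - mono m)
   + (theta r * mono m - mono (C j r :: m))); last by rewrite mulrBr mulrA addrA subrK.
by apply: std_spanD => //; move: f1; rewrite /weight rkC.
Qed.

(** In a linear relation over the polynomials in the [theta]'s, expanded over the
    ground field, a term of least weight cannot be cancelled. *)
Lemma free_cores : free_family theta_eval (fun j => mono (core j)).
Proof.
move=> u u0 j; apply/eqP/negPn/negP=> nzuj.
pose L := [seq (j, a) | j <- enum J, a <- msupp (u j)].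
have uL : uniq L.
  by apply: allpairs_uniq_dep => [|i _|]; rewrite ?enum_uniq // => -[? ?] [? ?] _ _ [-> ->].
pose W (x : J * 'X_{1..d}) := mweight (lifted_core x.1 x.2).
have [x0 x0L minx0] : exists2 x0, x0 \in L & forall x, x \in L -> (W x0 <= W x)%N.
  have [x xL] : exists x, x \in L.
    have [a aj] : exists a, a \in msupp (u j).
      case em: (msupp (u j)) => [|a l]; last by exists a; rewrite inE eqxx.
      by case/negP: nzuj; rewrite -msupp_eq0 em.
    by exists (j, a); apply/allpairsPdep; exists j, a; rewrite mem_enum.
  have [|n] := ex_minnP (P := fun n => has (fun x => W x == n) L).
    by exists (W x); apply/hasP; exists x.
  case/hasP=> x0 x0L /eqP <- minn0; exists x0 => // y yL.
  by apply: minn0; apply/hasP; exists y.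
pose c (x : J * 'X_{1..d}) := (u x.1)@_x.2.
have [s [/allP sA es]] : std_span (fun m => W x0 < mweight m)%N
    (- \sum_(x <- L) c x *: mono (lifted_core x.1 x.2)).
  rewrite -[X in std_span _ X]addr0 -[X in - _ + X]u0.
  rewrite (_ : \sum_j _ = \sum_(x <- L) c x *: (mmap1 theta x.2 * mono (core x.1))); last first.
    rewrite big_allpairs_dep /= big_enum /=; apply: eq_bigr => i _.
    by rewrite theta_evalE mulr_suml; apply: eq_bigr => a _; rewrite scalerAl.
  rewrite addrC -sumrB big_seq; apply: std_span_sum => x xL; rewrite -scalerBr.
  apply/std_spanZ/(std_spanW _ (theta_monomial_core _ _)) => m.
  by apply: leq_ltn_trans (minx0 _ xL).
pose s' := [seq (c x, lifted_core x.1 x.2) | x <- L] ++ s.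
have chs' : all (fun cm => multichain cm.2) s'.
  rewrite all_cat all_map; apply/andP; split.
    by apply/allP => x _; apply: lifted_core_multichain.
  by apply/allP => cm /sA/andP[].
have s'0 : lincomb s' = 0 by rewrite /lincomb big_cat /= big_map -[X in _ + X]es subrr.
have := lincomb_free (lifted_core x0.1 x0.2) chs' s'0; apply/eqP.
rewrite /coef_of big_cat /= big_map [X in _ + X]big_seq_cond.
rewrite [X in _ + X]big_pred0 ?addr0 => [|cm]; last first.
  by apply/negP=> /andP[/sA/andP[_ lt] /eqP e]; rewrite e ltnn in lt.
rewrite (big_rem x0) //= eqxx big_seq_cond big_pred0 ?addr0 => [|x]; last first.
  apply/negP=> /andP[xr /eqP/lifted_core_inj[e1 e2]].
  have ex : x = x0 by case: (x) (x0) e1 e2 => [? ?] [? ?] /= -> ->.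
  by move: xr; rewrite ex mem_rem_uniqF.
by move: x0L => /allpairsPdep[i [a [_ ai ->]]]; rewrite /c /= -mcoeff_msupp.
Qed.

End Cores.

End Straightening.

(** * Eyes as an obstruction to integrality *)

Lemma multichain_is_chain (disp : Order.disp_t) (P : finPOrderType disp) (m : seq P) :
  multichain m -> is_chain m.
Proof.
rewrite /multichain le_sorted_pairwise /is_chain.
rewrite -pairwise_all2rel; first last.
- by move=> p q; rewrite comparable_sym.
- exact: comparablexx.
by apply: sub_pairwise => p q; apply: le_comparable.
Qed.

Lemma not_uniq_perm (T : eqType) (m : seq T) :
  ~~ uniq m -> exists p m', perm_eq m (p :: m') /\ p \in m'.
Proof.
elim: m => //= p m IH; rewrite negb_and negbK.
have [pm _|npm /= /IH[q [m' [pm' qm']]]] := boolP (p \in m); first by exists p, m.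
exists q, (p :: m'); rewrite inE qm' orbT; split=> //.
rewrite -(perm_cons p) in pm'; apply: (perm_trans pm').
by apply/permP => a /=; rewrite addnCA.
Qed.

(** Here an eye is an element whose comparables all lie on one maximal chain,
    [C (inl i)], and the chains [C (inr w)] are maximal chains avoiding the eyes.
    The ground elements are all the other elements of the poset. *)
Section Obstruction.
Variables (disp : Order.disp_t) (P : finPOrderType disp) (d : nat) (rk : P -> 'I_d).
Hypothesis rk_lt : forall p q, (p < q)%O -> (rk p < rk q)%N.

Lemma comparable_rk_inj p q : (p >=< q)%O -> rk p = rk q -> p = q.
Proof.
by case/comparable_ltgtP => // /rk_lt lt e; rewrite e ltnn in lt.
Qed.

Variables (I Q W : finType) (eye : I -> P) (ground : Q -> P) (C : I + W -> 'I_d -> P).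
Hypotheses (ground_inj : injective ground)
  (coverP : forall p, (exists i, p = eye i) \/ (exists q, p = ground q))
  (rkC : forall j r, rk (C j r) = r)
  (chainC : forall j r s, (C j r >=< C j s)%O)
  (eye_chain : forall i p, (p >=< eye i)%O -> C (inl i) (rk p) = p)
  (eye_only : forall i j, C j (rk (eye i)) = eye i -> j = inl i)
  (facet_only : forall w j, C j =1 C (inr w) -> j = inr w)
  (lt_sets : (#|{set Q}| < #|I|)%N)
  (lt_pairs : (#|[set A : {set Q} | #|A| <= 2]| < #|W|)%N).

(** The two counts play against each other in [square_span_full]: the first makes
    the eyes more than half of the generators, and by the second the span of the
    part of degree at most 2 has smaller rank than R. *)
Lemma not_integral_of_eyes : ~ integral_poset P.
Proof.
move=> [K [R [G [phi [domR aslR phi1]]]]].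
pose ev := theta_eval phi rk.
pose set_mono (A : {set Q}) := std_monomial phi [seq ground q | q <- enum A].
pose g (x : I + {set Q}) := match x with inl i => phi (eye i) | inr A => set_mono A end.
pose T D := {A : {set Q} | #|A| <= D}%N.
pose h D (x : I + T D) := match x with inl i => phi (eye i) | inr A => set_mono (val A) end.
have spanT m : spanned_by ev (@h (size m)) (std_monomial phi m).
  (* An eye pins everything comparable with it, and an element pins itself, so the
     monomials that cannot be reduced are the single eyes and the squarefree
     products of ground elements. *)
  pose irr m := [exists i, m == [:: eye i]] || uniq m && [forall i, eye i \notin m].
  apply: (reduction_ind aslR phi1 rk_lt (V := fun D => spanned_by ev (@h D)) (irr := irr)).
  - by move=> D; apply: spanned0.
  - by move=> D x y; apply: spannedD.
  - move=> D k x Vx; have := spannedM k%:MP Vx.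
    by rewrite /ev /= /theta_eval mmapC mulr_algl.
  - move=> D r x Vx.
    have := spannedM 'X_r Vx; rewrite /ev /= /theta_eval mmapX mmap1U.
    apply: spanned_sub => -[i|[A leA]]; first exact: (spanned_gen _ _ (inl i)).
    exact: (spanned_gen _ (@h D.+1) (inr (exist _ A (leqW leA)))).
  - move=> {}m chm /orP[/existsP[i /eqP ->]|/andP[um /forallP nem]].
      have := spanned_gen ev (@h 1) (inl i).
      by rewrite /= /std_monomial big_seq1.
    pose A := [set q | ground q \in m].
    have pm : perm_eq m [seq ground q | q <- enum A].
      apply: uniq_perm => //; first by rewrite map_inj_uniq ?enum_uniq.
      move=> p; apply/idP/mapP => [pm|[q + ->]]; last by rewrite mem_enum inE.
      have [[i ep]|[q ep]] := coverP p; first by rewrite ep (negbTE (nem i)) in pm.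
      by exists q; rewrite // mem_enum inE -ep.
    have leA : (#|A| <= size m)%N by rewrite (perm_size pm) size_map cardE.
    rewrite (mono_perm _ pm).
    exact: (spanned_gen _ (@h (size m)) (inr (exist _ A leA))).
  move=> {}m /multichain_is_chain/is_chainP chm; rewrite negb_or => /andP[/existsPn ne1].
  rewrite negb_and negb_forall; case/orP => [/not_uniq_perm[p [m' [pm pm']]]|].
    by exists p, m'; split=> // q rkq /(_ p pm')/comparable_rk_inj; apply.
  case/existsP=> i; rewrite negbK => im.
  have pm := perm_to_rem im; case em: (rem (eye i) m) pm => [|p m'] pm.
    by case/eqP: (ne1 i); apply/perm_small_eq.
  exists p, (eye i :: m'); split.
    by rewrite (perm_trans pm) //; apply/permP => a /=; rewrite addnCA.
  move=> q rkq /(_ (eye i) (mem_head _ _))/eye_chain <-; rewrite rkq.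
  by apply: eye_chain; apply: chm => //; rewrite (perm_mem pm) !inE eqxx orbT.
have spang r : spanned_by ev g r.
  have [t [c [_ ->]]] := asl_span aslR r; apply: spanned_sum => m.
  rewrite -mulr_algl.
  have -> : (c m)%:A = ev (c m)%:MP by rewrite /ev /= /theta_eval mmapC.
  apply: spannedM; apply: spanned_sub (spanT m) => -[i|A].
    exact: (spanned_gen _ g (inl i)).
  exact: (spanned_gen _ g (inr (val A))).
(* The core of an eye's chain is the eye alone. *)
pose core j := match j with inl i => [:: eye i] | inr w => codom (C (inr w)) end.
have freeM : free_family ev (fun j => std_monomial phi (core j)).
  apply: (free_cores aslR phi1 rk_lt rkC chainC).
  - case=> [i|w] p; first by rewrite inE => /eqP ->; apply/eye_chain/comparablexx.
    by case/codomP=> r ->; rewrite rkC.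
  - case=> [i|w] r q; rewrite rkC => rkq chq.
      by rewrite -(eye_chain (chq (eye i) _)) ?mem_head // rkq.
    by apply: comparable_rk_inj; rewrite ?rkC //; apply/chq/codom_f.
  case=> [i|w] j' Cj'; first by rewrite (eye_only (Cj' _ (mem_head _ _))).
  symmetry; apply: facet_only => r.
  by have := Cj' _ (codom_f (C (inr w)) r); rewrite rkC.
have freeX : free_family ev (fun i => g (inl i)).
  move=> u u0 i.
  pose u' (j : I + W) := if j is inl i then u i else 0.
  apply: (freeM u' _ (inl i)); rewrite big_sumType /= [X in _ + X]big1 ?addr0.
    by rewrite -[RHS]u0; apply: eq_bigr => k _; rewrite /std_monomial big_seq1.
  by move=> w _; rewrite rmorph0 mul0r.
have sqX i i' : spanned_by ev (@h 2) (g (inl i) * g (inl i')).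
  by have := spanT [:: eye i; eye i']; rewrite /std_monomial big_cons big_seq1.
have := square_span_full domR freeX spang sqX freeM lt_sets.
rewrite !card_sum leq_add2l leqNgt => /negP; apply.
by rewrite card_sig; move: lt_pairs; rewrite cardsE.
Qed.

End Obstruction.

(** * Grids with eyes *)

Local Open Scope nat_scope.

(** One inequality of the modular law always holds, and the rank identity gives
    both sides the same rank. *)
Lemma modular_of_rank (disp : Order.disp_t) (T : latticeType disp) (rho : T -> nat) :
  (forall x y : T, (x < y)%O -> rho x < rho y) ->
  (forall x y : T, rho x + rho y = rho (x `|` y)%O + rho (x `&` y)%O) ->
  modular_lattice T.
Proof.
move=> rho_lt rhoD a b c ac.
have le_uv : (a `|` (b `&` c) <= (a `|` b) `&` c)%O.
  by rewrite leUx !lexI leUl ac leIr (le_trans (leIl b c)) ?leUr.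
have e_uv : rho (a `|` (b `&` c))%O = rho ((a `|` b) `&` c)%O.
  have e1 : (a `&` (b `&` c) = a `&` b)%O by rewrite meetCA (meet_idPl ac) meetC.
  have e2 : (a `|` b `|` c = b `|` c)%O by rewrite joinAC (join_r ac) joinC.
  have := rhoD a (b `&` c)%O; have := rhoD (a `|` b)%O c; rewrite e1 e2.
  move: {e1 e2} (rhoD a b) (rhoD b c) => e1 e2 e3 e4.
  apply: (@addIn (rho (a `&` b)%O)); rewrite -e4; apply: (@addnI (rho (b `|` c)%O)).
  by rewrite [RHS]addnA -e3; lia.
apply/eqP; move: le_uv; rewrite le_eqVlt => /orP[//|/rho_lt].
by rewrite e_uv ltnn.
Qed.

Definition grid (k : nat) : finType := ('I_k.+2 * 'I_k.+2)%type.
(** The grid is {0,...,k+1}^2, of width k+2, so that the bottom (k,0) and the top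
    (k+1,1) of the square that receives the eyes exist for every [k]. *)
Definition eyed_grid (k n : nat) := (grid k + 'I_n)%type.
HB.instance Definition _ k n := Finite.on (eyed_grid k n).

Section EyedGrid.
Variables (k n : nat).
Local Notation L := (eyed_grid k n).

(** An eye is seen as the interval from (k,0) to (k+1,1) and a grid point as an
    interval reduced to a point; distinct elements are then ordered as intervals,
    one ending before the other begins. *)
Definition lo1 (x : L) : nat := if x is inl p then p.1 else k.
Definition lo2 (x : L) : nat := if x is inl p then p.2 else 0.
Definition hi1 (x : L) : nat := if x is inl p then p.1 else k.+1.
Definition hi2 (x : L) : nat := if x is inl p then p.2 else 1.

Definition node (i j : nat) : L := inl (inord i, inord j).

Definition eyed_le (x y : L) : bool :=
  (x == y) || (hi1 x <= lo1 y) && (hi2 x <= lo2 y).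

Lemma lo1_le x : lo1 x <= hi1 x. Proof. by case: x. Qed.
Lemma lo2_le x : lo2 x <= hi2 x. Proof. by case: x. Qed.
Lemma hi1_lt x : hi1 x < k.+2. Proof. by case: x => [[i j]|e] /=. Qed.
Lemma hi2_lt x : hi2 x < k.+2. Proof. by case: x => [[i j]|e] /=. Qed.

(** A degenerate interval cannot be an eye, so it determines its element. *)
Lemma hi_eq_lo (x y : L) : hi1 x = lo1 y -> hi2 x = lo2 y -> hi1 y = lo1 y -> hi1 x = lo1 x ->
  x = y.
Proof.
case: x y => [[i j]|e] [[i' j']|e'] /= e1 e2 e3 e4; try lia.
by congr inl; congr pair; apply: val_inj.
Qed.

Lemma eyed_le_refl : reflexive eyed_le.
Proof. by move=> x; rewrite /eyed_le eqxx. Qed.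

Lemma eyed_le_anti : antisymmetric eyed_le.
Proof.
move=> x y; rewrite /eyed_le eq_sym; have [//|_ /=] := eqVneq y x.
move=> /andP[/andP[h1 h2] /andP[h3 h4]].
have := lo1_le x; have := lo1_le y; have := lo2_le x; have := lo2_le y.
by move=> *; apply: hi_eq_lo; lia.
Qed.

Lemma eyed_le_trans : transitive eyed_le.
Proof.
move=> y x z /orP[/eqP -> //|/andP[h1 h2]] /orP[/eqP <-|/andP[h3 h4]].
  by rewrite /eyed_le h1 h2 orbT.
have := lo1_le y; have := lo2_le y => *.
by apply/orP; right; apply/andP; split; lia.
Qed.

Fact eyed_display : Order.disp_t. Proof. exact: Order.Disp tt tt. Qed.

HB.instance Definition _ :=
  Order.Le_isPOrder.Build eyed_display L eyed_le_refl eyed_le_anti eyed_le_trans.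

Lemma eyed_leE (x y : L) : (x <= y)%O = (x == y) || (hi1 x <= lo1 y) && (hi2 x <= lo2 y).
Proof. by []. Qed.

Lemma lo1_node i j : i < k.+2 -> lo1 (node i j) = i.
Proof. by move=> lti; rewrite /= inordK. Qed.
Lemma lo2_node i j : j < k.+2 -> lo2 (node i j) = j.
Proof. by move=> ltj; rewrite /= inordK. Qed.

Definition eyed_join (x y : L) : L :=
  if (x <= y)%O then y else if (y <= x)%O then x
  else node (maxn (hi1 x) (hi1 y)) (maxn (hi2 x) (hi2 y)).

Definition eyed_meet (x y : L) : L :=
  if (x <= y)%O then x else if (y <= x)%O then y
  else node (minn (lo1 x) (lo1 y)) (minn (lo2 x) (lo2 y)).

Lemma eyed_joinP x y z : (eyed_join x y <= z)%O = (x <= z)%O && (y <= z)%O.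
Proof.
rewrite /eyed_join.
have [xy|nxy] := boolP (x <= y)%O.
  by apply/idP/andP => [yz|[]//]; split=> //; apply: le_trans yz.
have [yx|nyx] := boolP (y <= x)%O.
  by apply/idP/andP => [xz|[]//]; split=> //; apply: le_trans xz.
have := hi1_lt x; have := hi1_lt y; have := hi2_lt x; have := hi2_lt y => *.
have lt1 : maxn (hi1 x) (hi1 y) < k.+2 by lia.
have lt2 : maxn (hi2 x) (hi2 y) < k.+2 by lia.
have hi1n := lo1_node (maxn (hi2 x) (hi2 y)) lt1.
have hi2n := lo2_node (maxn (hi1 x) (hi1 y)) lt2.
apply/idP/andP => [nz|[xz yz]].
  split; apply: le_trans nz; rewrite eyed_leE hi1n hi2n; lia.
move: xz; rewrite eyed_leE => /orP[/eqP exz|/andP[x1 x2]].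
  by rewrite exz yz in nyx.
move: yz; rewrite eyed_leE => /orP[/eqP eyz|/andP[y1 y2]].
  by rewrite eyed_leE eyz x1 x2 orbT in nxy.
rewrite eyed_leE; apply/orP; right.
by rewrite -[hi1 (node _ _)]/(lo1 (node _ _)) -[hi2 (node _ _)]/(lo2 (node _ _)) hi1n hi2n; lia.
Qed.

Lemma eyed_meetP x y z : (x <= eyed_meet y z)%O = (x <= y)%O && (x <= z)%O.
Proof.
rewrite /eyed_meet.
have [yz|nyz] := boolP (y <= z)%O.
  by apply/idP/andP => [xy|[]//]; split=> //; apply: le_trans yz.
have [zy|nzy] := boolP (z <= y)%O.
  by apply/idP/andP => [xz|[]//]; split=> //; apply: le_trans zy.
have := hi1_lt y; have := hi1_lt z; have := hi2_lt y; have := hi2_lt z.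
have := lo1_le y; have := lo1_le z; have := lo2_le y; have := lo2_le z => *.
have lt1 : minn (lo1 y) (lo1 z) < k.+2 by lia.
have lt2 : minn (lo2 y) (lo2 z) < k.+2 by lia.
have lo1n := lo1_node (minn (lo2 y) (lo2 z)) lt1.
have lo2n := lo2_node (minn (lo1 y) (lo1 z)) lt2.
apply/idP/andP => [nx|[xy xz]].
  split; apply: (le_trans nx); rewrite eyed_leE;
  by rewrite -[hi1 (node _ _)]/(lo1 (node _ _)) -[hi2 (node _ _)]/(lo2 (node _ _)) lo1n lo2n; lia.
move: xy; rewrite eyed_leE => /orP[/eqP exy|/andP[x1 x2]].
  by rewrite -exy xz in nyz.
move: xz; rewrite eyed_leE => /orP[/eqP exz|/andP[x3 x4]].
  by rewrite eyed_leE -exz x1 x2 orbT in nzy.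
by rewrite eyed_leE; apply/orP; right; rewrite lo1n lo2n; lia.
Qed.

HB.instance Definition _ :=
  Order.POrder_MeetJoin_isLattice.Build eyed_display L eyed_meetP eyed_joinP.

Definition level (x : L) : nat := if x is inl p then p.1 + p.2 else k.+1.

Lemma level_lt (x y : L) : (x < y)%O -> level x < level y.
Proof.
rewrite lt_neqAle eyed_leE => /andP[nxy]; rewrite (negbTE nxy) /= => /andP[h1 h2].
rewrite ltnNge; apply/negP => le_yx.
case/eqP: nxy; apply: hi_eq_lo; move: x y h1 h2 le_yx => [[i j]|e] [[i' j']|e'] /=; lia.
Qed.

(** For an eye and a grid point (i,j) that are incomparable, either i = k+1 and
    j = 0, or i <= k and j >= 1; in both cases the join and the meet lie on the
    right and lower sides of the grid. *)
Lemma level_modular (x y : L) :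
  level x + level y = level (x `|` y)%O + level (x `&` y)%O.
Proof.
rewrite -[(x `|` y)%O]/(eyed_join x y) -[(x `&` y)%O]/(eyed_meet x y) /eyed_join /eyed_meet.
have [_|nxy] := boolP (x <= y)%O; first exact: addnC.
have [_ //|nyx] := boolP (y <= x)%O.
rewrite /level /= !inordK.
2-5: by move: (hi1_lt x) (hi1_lt y) (hi2_lt x) (hi2_lt y) (lo1_le x) (lo1_le y) (lo2_le x)
  (lo2_le y); lia.
move: nxy nyx; rewrite !eyed_leE !negb_or => /andP[_ h1] /andP[_ h2].
case: x y h1 h2 => [[i j]|e] [[i' j']|e'] /=; first lia.
- have := ltn_ord i; have := ltn_ord j; lia.
- have := ltn_ord i'; have := ltn_ord j'; lia.
- lia.
Qed.

Lemma eyed_modular : modular_lattice L.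
Proof. exact: modular_of_rank level_lt level_modular. Qed.

End EyedGrid.

(** * Maximal chains of a grid with eyes *)

Section EyedGridChains.
Variables (k n : nat).
Local Notation L := (eyed_grid k n).
Local Notation d := (k.+1).*2.+1.

Lemma level_ub (x : L) : level x < d.
Proof. by case: x => [[[i lti] [j ltj]]|e] /=; lia. Qed.

Definition rank (x : L) : 'I_d := Ordinal (level_ub x).

Lemma node_eq (i j : 'I_k.+2) (i' j' : nat) : i = i' :> nat -> j = j' :> nat ->
  node k n i' j' = inl (i, j).
Proof. by move=> <- <-; rewrite /node !inord_val. Qed.

Lemma level_node i j : i < k.+2 -> j < k.+2 -> level (node k n i j) = i + j.
Proof. by move=> lti ltj; rewrite /= !inordK. Qed.

Lemma node_le i j i' j' : i <= i' -> j <= j' -> i' < k.+2 -> j' < k.+2 ->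
  (node k n i j <= node k n i' j')%O.
Proof.
move=> lei lej lti' ltj'; rewrite eyed_leE; apply/orP; right.
by rewrite /= !inordK ?lei //; lia.
Qed.

Definition eye (e : 'I_n) : L := inr e.

(** Up the lower side of the grid, through the eye, then up the right side. *)
Definition eye_path (e : 'I_n) (r : nat) : L :=
  if r <= k then node k n r 0 else if r == k.+1 then eye e else node k n k.+1 (r - k.+1).

(** Passes through all diagonal points (i,i), turning to (i+1,i) when [i] is in
    [w] and to (i,i+1) otherwise. *)
Definition zigzag (w : {set 'I_k.+1}) (r : nat) : L :=
  let right := odd r && (inord r./2 \in w) in
  node k n (r./2 + right) (r./2 + (odd r && ~~ right)).

Definition chains (j : 'I_n + {set 'I_k.+1}) (r : 'I_d) : L :=
  match j with inl e => eye_path e r | inr w => zigzag w r end.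

Lemma level_chains j r : rank (chains j r) = r.
Proof.
apply: ord_inj; rewrite -[LHS]/(level _).
have ltr := ltn_ord r; case: j => [e|w]; rewrite /chains.
  rewrite /eye_path; case: leqP => h1; first by rewrite level_node; lia.
  by case: eqP => [->//|h2]; rewrite level_node; lia.
by rewrite /zigzag; case: (_ \in w); rewrite level_node; lia.
Qed.

Lemma chains_mono j (r s : 'I_d) : r < s -> (chains j r <= chains j s)%O.
Proof.
case: r s => r ltr [s lts] /= ltrs; case: j => [e|w].
  rewrite /chains /eye_path /=; case: (leqP r k) => h1; case: (leqP s k) => h2; try lia.
  - by apply: node_le; lia.
  - case: eqP => h3; last by apply: node_le; lia.
    by rewrite eyed_leE /= !inordK; lia.
  - case: (r =P k.+1) => h3; case: (s =P k.+1) => h4; try lia.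
      by rewrite eyed_leE /= !inordK; lia.
    by apply: node_le; lia.
rewrite /chains /zigzag /=; case: (_ \in w); case: (_ \in w); apply: node_le; lia.
Qed.

Lemma comparable_chains j r s : (chains j r >=< chains j s)%O.
Proof.
rewrite /Order.comparable; case: (ltngtP r s) => [/chains_mono -> //|/chains_mono ->|/val_inj ->].
  by rewrite orbT.
by rewrite lexx.
Qed.

(** Below (k,0) there is only the lower side of the grid, and above (k+1,1) only
    its right side: this is why the eyes are put in a corner. *)
Lemma eye_pathP e (x : L) : (x >=< eye e)%O -> chains (inl e) (rank x) = x.
Proof.
rewrite /Order.comparable !eyed_leE eq_sym => h.
have {}h : x = eye e \/ (hi1 x <= k) && (hi2 x <= 0) || (k < lo1 x) && (0 < lo2 x).
  move: h; have [-> |_ /= h] := eqVneq (eye e) x; first by left.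
  by right.
case: h => [-> |]; first by rewrite /= /eye_path /= ltnn eqxx.
case: x => [[[i lti] [j ltj]]|e'] /=; last lia.
rewrite /eye_path => h; case: ifP => h1; first by apply: node_eq => /=; lia.
by case: ifP => h2; first lia; apply: node_eq => /=; lia.
Qed.

Lemma eye_chains e j : chains j (rank (eye e)) = eye e -> j = inl e.
Proof. by case: j => [e'|w] //=; rewrite /eye_path /= ltnn eqxx => -[->]. Qed.

Lemma zigzag_chains (w : {set 'I_k.+1}) j : chains j =1 chains (inr w) -> j = inr w.
Proof.
case: j => [e|w'] /= ew.
  have lt : k.+1 < d by lia.
  by have := ew (Ordinal lt); rewrite /= /eye_path ltnn eqxx.
congr inr; apply/setP=> i.
have lt : i.*2.+1 < d by have := ltn_ord i; lia.
have oddi : odd i.*2.+1 by rewrite /= odd_double.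
have halfi : i.*2.+1./2 = i by rewrite -[LHS]/(uphalf _) uphalf_double.
have : zigzag w' i.*2.+1 = zigzag w i.*2.+1 := ew (Ordinal lt).
rewrite /zigzag oddi halfi inord_val.
move/(congr1 (@lo1 k n)); by rewrite !lo1_node; case: (_ \in _) (ltn_ord i); lia.
Qed.

Lemma eyed_grid_not_integral :
  #|{set grid k}| < n -> #|[set A : {set grid k} | #|A| <= 2]| < 2 ^ k.+1 ->
  ~ integral_poset L.
Proof.
move=> lt_sets lt_pairs.
apply: (@not_integral_of_eyes _ _ _ rank _ 'I_n (grid k) {set 'I_k.+1} eye (fun p => inl p) chains).
- exact: level_lt.
- by move=> p q [].
- by case=> [p|e]; [right; exists p | left; exists e].
- exact: level_chains.
- exact: comparable_chains.
- exact: eye_pathP.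
- exact: eye_chains.
- exact: zigzag_chains.
- by rewrite card_ord.
- by rewrite -cardsT -powersetT card_powerset cardsT card_ord.
Qed.

End EyedGridChains.

Lemma card_small_sets (T : finType) : #|[set A : {set T} | #|A| <= 2]| <= (#|T| ^ 2).+1.
Proof.
pose f (x : option (T * T)) : {set T} := if x is Some p then [set p.1; p.2] else set0.
have <- : #|{: option (T * T)}| = (#|T| ^ 2).+1 by rewrite card_option card_prod.
apply: leq_trans (leq_imset_card f _); apply: subset_leq_card.
apply/subsetP=> A; rewrite inE => leA; apply/imsetP.
have [->|[p pA]] := set_0Vmem A; first by exists None.
have := cardsD1 p A; rewrite pA.
have [Ap|[q]] := set_0Vmem (A :\ p).
  by exists (Some (p, p)) => //=; rewrite setUid -(setD1K pA) Ap setU0.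
rewrite !inE => /andP[nqp qA]; have := cardsD1 q (A :\ p); rewrite !inE nqp qA /=.
move=> e1 e2; have /eqP : #|A :\ p :\ q| = 0 by lia.
rewrite cards_eq0 => /eqP e0; exists (Some (p, q)) => //=.
rewrite -(setD1K pA) -(@setD1K _ q (A :\ p)) ?inE ?nqp // e0 setU0.
by [].
Qed.

Theorem theorem3p3 :
  exists (d : Order.disp_t) (L : finLatticeType d),
    modular_lattice L /\ ~ integral_poset L.
Proof.
(* [k = 16] is the least value for which the bound (k+2)^4 + 1 on the number of
   products of at most two grid elements is below 2^(k+1). *)
exists eyed_display, (eyed_grid 16 #|{set grid 16}|.+1); split; first exact: eyed_modular.
apply: eyed_grid_not_integral => //.
apply: leq_ltn_trans (card_small_sets _) _.
rewrite card_prod !card_ord.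
by vm_compute.
Qed.
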